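(* Let $p>q$ be odd primes with $p\equiv1\pmod q$, and let $G$ be the non-abelian group of order $pq$, given by generators $a,b$ with relations $a^q=b^p=e$ and $ba=ab^s$, where $s\not\equiv1$ and $s^q\equiv1\pmod p$. Then the saturated subsets of $G$ are all of the form $\{x,x^n\}$ with $x\in G$ and $n$ an integer.
   Context: For a group $S$, a subset $U\subseteq S$ is avoidable if there is a partition $\{A,B\}$ of $S$ such that no element of $U$ equals $xy$ with $x\neq y$ both in $A$ or both in $B$ (in either order). A subset is saturated if it is maximal with respect to inclusion among the avoidable subsets. *)

(* Defs.v *)
From mathcomp Require Import all_boot all_fingroup.

Set Implicit Arguments.
Unset Strict Implicit.
Unset Printing Implicit Defensive.

Local Open Scope group_scope.

(* [A != B] rules out the one-block partition [set A; A] = [set G].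
   Both orders [x * y] and [y * x] are covered, as [x] and [y] each range
   over the whole block. *)
Definition avoidable (gT : finGroupType) (G : {group gT}) (U : {set gT}) :
    bool :=
  (U \subset G) &&
  [exists A : {set gT}, exists B : {set gT},
    [&& A != B, partition [set A; B] G,
        [forall x in A, forall y in A, (x != y) ==> (x * y \notin U)]
      & [forall x in B, forall y in B, (x != y) ==> (x * y \notin U)]]].

Definition saturated (gT : finGroupType) (G : {group gT}) (U : {set gT}) :
    bool :=
  maxset (avoidable G) U.

(* Main.v *)
(** Write an avoiding partition as a 2-colouring: [x] and [y] get different
    colours when [x != y] and [x * y \in U].  For [u \in U] the step
    [x |-> x^-1 * u] changes colour unless [x ^+ 2 = u], and two steps are
    conjugation by [u]; so the colouring is invariant under conjugation by
    every element of [U].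
    - If [u], [v] in [U] do not commute, they generate [G], so the colouring is
      a class function.  One of them, say [u], lies outside the normal subgroup
      [P] of order [p].  If [w] is the square root of [u], the coset [w *: P]
      is a single [P]-class, hence monochromatic; but [x |-> x^-1 * u] maps it
      to itself and changes the colour of every [x != w].
    - If [u], [v], [w] in [U] are distinct and commute, the square root [x] of
      [u * v^-1 * w] starts a triangle with edge products [w], [v], [u].
    So [U] consists of at most two elements, and they commute; commuting
    elements of [G] lie in a common cyclic subgroup of prime order. *)
Require Import Defs.
From mathcomp Require Import all_boot all_fingroup all_solvable.

Local Open Scope group_scope.

Lemma dvdn_mul_primes {p q d : nat} :
  prime p -> prime q -> (d %| p * q)%N -> d \in [:: 1; p; q; p * q]%N.
Proof.
move=> pp pq; have [/dvdnP[e ->]|npd] := boolP (p %| d)%N.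
  rewrite mulnC dvdn_pmul2l ?prime_gt0 // => /(primeP pq).2.
  by case/orP=> /eqP->; rewrite !inE ?muln1 eqxx ?orbT.
rewrite Gauss_dvdr; last by rewrite coprime_sym prime_coprime.
by move/(primeP pq).2; case/orP=> /eqP->; rewrite !inE eqxx ?orbT.
Qed.

(** * Square roots and 2-colourings in a group of odd order *)

Section OddGroup.

Set Implicit Arguments.
Unset Strict Implicit.

Variables (gT : finGroupType) (G : {group gT}).
Hypothesis oddG : odd #|G|.

Lemma odd_sqrt (u : gT) :
  u \in G -> exists2 w, w \in <[u]> & w ^+ 2 = u.
Proof.
(* As [#|G|] is odd, twice this exponent is exactly [#|G|.+1]. *)
move=> Gu; exists (u ^+ (#|G|.+1)./2); first exact: mem_cycle.
rewrite -expgM muln2 halfK /= oddG subn0.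
by rewrite expgS expg_cardG // mulg1.
Qed.

Lemma odd_sqrt_inj (x y : gT) : x \in G -> y \in G -> x ^+ 2 = y ^+ 2 -> x = y.
Proof.
have sqrtK z : z \in G -> (z ^+ 2) ^+ (#|G|.+1)./2 = z.
  move=> Gz; rewrite -expgM mulnC muln2 halfK /= oddG subn0.
  by rewrite expgS expg_cardG // mulg1.
by move=> Gx Gy eq2; rewrite -(sqrtK x) // eq2 sqrtK.
Qed.

(** Rules out the empty set as a saturated set. Only pairs of inverses have product [1], and in odd
    order no [x != 1] is its own inverse, so it suffices to separate each [x != 1] from [x^-1]. *)
Lemma avoidable1 : G :!=: 1 -> avoidable G [set 1].
Proof.
case/trivgPn=> x0 Gx0 nx0.
have invN x : x \in G -> x != 1 -> x != x^-1.
  move=> Gx; apply: contra => /eqP eqx; apply/eqP/odd_sqrt_inj => //.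
  by rewrite expg1n expgS expg1 {2}eqx mulgV.
(* [enum_rank] is just a total order that selects one element of each pair of inverses; [1] falls
   into [B]. *)
pose A := [set x in G | (enum_rank x < enum_rank x^-1)%N].
pose B := G :\: A.
have B1 : 1 \in B by rewrite !inE invg1 ltnn andbF group1.
have [a Aa] : exists a, a \in A.
  have := invN x0 Gx0 nx0; rewrite -(inj_eq enum_rank_inj) -val_eqE /= neq_ltn.
  case/orP=> lt; [exists x0 | exists x0^-1]; rewrite !inE ?groupV Gx0 //.
  by rewrite invgK.
have dAB : [disjoint A & B].
  by rewrite -setI_eq0; apply/eqP/setP=> x; rewrite !inE; case: (x \in G) => //=; case: ltnP.
have nAB : A != B.
  by apply: contraTneq B1 => <-; rewrite !inE invg1 ltnn andbF.
apply/andP; split; first by rewrite sub1set group1.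
apply/existsP; exists A; apply/existsP; exists B; apply/and4P; split=> //.
- apply/and3P; split.
  + rewrite /cover bigcup_setU !big_set1; apply/eqP/setP=> x.
    by rewrite !inE; case: (x \in G) => //=; case: ltnP.
  + apply/trivIsetP=> X Y; rewrite !inE.
    case/orP=> /eqP-> /orP[] /eqP-> // nXY; rewrite ?eqxx // in nXY *.
    by rewrite disjoint_sym.
  + rewrite !inE negb_or; apply/andP; split; apply/eqP=> E0.
      by rewrite -E0 inE in Aa.
    by rewrite -E0 inE in B1.
- apply/forall_inP=> x Ax; apply/forall_inP=> y Ay; apply/implyP=> _.
  rewrite inE -eq_invg_mul; apply/eqP=> yE; move: Ax Ay.
  rewrite -yE !inE invgK => /andP[_ lt1] /andP[_ lt2].
  by have := ltn_trans lt1 lt2; rewrite ltnn.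
- apply/forall_inP=> x Bx; apply/forall_inP=> y By; apply/implyP=> nxy.
  rewrite inE -eq_invg_mul; apply/eqP=> yE; move: Bx By nxy.
  rewrite -yE !inE groupV invgK => /andP[+ Gx] /andP[].
  rewrite Gx /= -!leqNgt => le1 le2 _ /eqP[]; apply/enum_rank_inj/val_inj.
  by apply/eqP; rewrite eqn_leq le1 le2.
Qed.

Lemma avoidable_coloring (U : {set gT}) :
  avoidable G U ->
  exists2 A : {set gT}, A \subset G &
    {in G &, forall x y, x != y -> x * y \in U -> (y \in A) = (x \notin A)}.
Proof.
case/andP=> _ /existsP[A /existsP[B /and4P[nAB partG]]].
move=> /forall_inP avA /forall_inP avB.
have defG : A :|: B = G.
  by rewrite -(cover_partition partG) /cover bigcup_setU !big_set1.
have dAB x : x \in A -> x \in B -> False.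
  case/and3P: partG => _ /trivIsetP/(_ A B) dAB _ Ax Bx.
  have:= dAB _ _ nAB; rewrite !inE !eqxx orbT => /(_ isT isT)/pred0P/(_ x).
  by rewrite /= Ax Bx.
exists A; first by rewrite -defG subsetUl.
move=> x y; rewrite -{1 2}defG !inE => ABx ABy nxy Uxy.
have {}avA z t : z \in A -> t \in A -> z != t -> z * t \notin U.
  by move=> Az At nzt; apply: (implyP (forall_inP (avA z Az) t At)).
have {}avB z t : z \in B -> t \in B -> z != t -> z * t \notin U.
  by move=> Bz Bt nzt; apply: (implyP (forall_inP (avB z Bz) t Bt)).
have [Ax | nAx] := boolP (x \in A) => /=.
  by apply/negP=> Ay; have:= avA x y Ax Ay nxy; rewrite Uxy.
case/orP: ABy => // By; rewrite (negPf nAx) /= in ABx.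
by have:= avB x y ABx By nxy; rewrite Uxy.
Qed.

Section Coloring.

Variables U A : {set gT}.
Hypotheses (sUG : U \subset G) (sAG : A \subset G).
Hypothesis colA :
  {in G &, forall x y, x != y -> x * y \in U -> (y \in A) = (x \notin A)}.

Lemma coloring_step (u x : gT) :
  u \in U -> x \in G -> x ^+ 2 != u -> (x^-1 * u \in A) = (x \notin A).
Proof.
move=> Uu Gx nx2; have Gu := subsetP sUG u Uu.
apply: colA; rewrite ?groupM ?groupV ?mulKVg //.
by apply: contra nx2 => /eqP xE; rewrite expgS expg1 {2}xE mulKVg.
Qed.

Lemma coloring_norm (u : gT) : u \in U -> u \in 'N(A).
Proof.
move=> Uu; have Gu := subsetP sUG u Uu.
have conjA x : x \in G -> (x ^ u \in A) = (x \in A).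
  (* At a square root of [u] no step is available, but conjugation by [u] fixes it. *)
  move=> Gx; have [x2 | nx2] := eqVneq (x ^+ 2) u.
    by have /commgP/conjg_fixP-> : commute x u by rewrite -x2; apply: commuteX.
  rewrite -[RHS]negbK -(coloring_step Uu Gx nx2).
  have -> : x ^ u = (x^-1 * u)^-1 * u by rewrite invMg invgK conjgE mulgA.
  apply: coloring_step; rewrite ?groupM ?groupV //.
  (* The second step is legitimate too: if [x^-1 * u] squares to [u], it equals [x]. *)
  apply: contra nx2 => /eqP y2.
  suff yx : x^-1 * u = x by rewrite expgS expg1 -{2}yx mulKVg.
  by apply: (mulIg (x^-1 * u)); rewrite mulKVg -[RHS]y2 expgS expg1.
rewrite inE; apply/subsetP=> _ /imsetP[x Ax ->].
by rewrite conjA // (subsetP sAG).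
Qed.

Lemma no_commuting_triple (u v w : gT) :
  u \in U -> v \in U -> w \in U -> commute u v -> commute v w -> commute u w ->
  u != v -> v != w -> u != w -> False.
Proof.
move=> Uu Uv Uw cuv cvw cuw nuv nvw nuw.
have [Gu Gv Gw] : [/\ u \in G, v \in G & w \in G] by split; apply: (subsetP sUG).
(* For commuting [x], [y], [z] with [x * y = w], [y * z = v] and [z * x = u], the product
   [u * v^-1 * w] is [x ^+ 2]. *)
pose t := u * v^-1 * w.
have Gt : t \in G by rewrite !groupM ?groupV.
have [x xt x2] := odd_sqrt Gt.
have Gx : x \in G by apply: subsetP xt; rewrite cycle_subG.
have tP z : commute z u -> commute z v -> commute z w -> commute z x.
  move=> czu czv czw; case/cycleP: xt => n ->; apply: commuteX.
  by apply: commuteM => //; apply: commuteM => //; apply: commuteV.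
have cvx : commute v x by apply: tP => //; apply: commute_sym.
have cwx : commute w x by apply: tP => //; apply: commute_sym.
have xx : x * x = u * v^-1 * w by rewrite -[RHS]x2 expgS expg1.
pose y := x^-1 * w; pose z := y^-1 * v.
have Gy : y \in G by rewrite groupM ?groupV.
have Gz : z \in G by rewrite groupM ?groupV.
have zx : z * x = u.
  rewrite /z /y invMg invgK -!mulgA cvx (mulgA x) xx.
  by rewrite -!mulgA -cvw mulKg cuw mulKg.
(* No edge of the triangle degenerates: equal ends of one edge would make the products on the other
   two edges equal. *)
have x_w : x ^+ 2 != w.
  apply: contra nuv; rewrite x2 /t -{2}[w]mul1g => /eqP/mulIg/eqP.
  by rewrite -eq_mulgV1.
have yx : y * x = w by rewrite /y -mulgA cwx mulKg.
have y_v : y ^+ 2 != v.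
  apply: contra nuw => /eqP y2; rewrite -zx -yx.
  by rewrite /z -{1}y2 expgS expg1 mulKg.
have z_u : z ^+ 2 != u.
  apply: contra nvw => /eqP z2; rewrite -yx.
  suff <- : z = x by rewrite /z mulKVg.
  by apply: (mulgI z); rewrite zx -z2 expgS expg1.
have zu : z^-1 * u = x by rewrite -zx mulKg.
have := coloring_step Uu Gz z_u; rewrite zu (coloring_step Uv Gy y_v).
by rewrite (coloring_step Uw Gx x_w) negbK; case: (x \in A).
Qed.

End Coloring.

End OddGroup.

(** * Non-abelian groups of order [p * q] *)

Section OrderPQ.

Set Implicit Arguments.
Unset Strict Implicit.

Variables (p q : nat) (gT : finGroupType) (G : {group gT}).
Hypotheses (pp : prime p) (pq : prime q) (ltqp : (q < p)%N).
Hypotheses (nabG : ~~ abelian G) (oG : #|G| = (p * q)%N).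

Lemma proper_card_pq (H : {group gT}) :
  H \subset G -> H :!=: G -> H :=: 1 \/ prime #|H|.
Proof.
move=> sHG nHG; have:= cardSg sHG; rewrite oG => /(dvdn_mul_primes pp pq).
rewrite !inE => /or4P[] /eqP oH; rewrite ?oH; auto.
  by left; apply: card1_trivg.
by case/eqP: nHG; apply/eqP; rewrite eqEcard sHG oG oH leqnn.
Qed.

(** The subgroup generated by [u] and [v] is abelian, hence proper, hence of prime order, so its
    non-trivial element [u] generates it. *)
Lemma commute_cycle (u v : gT) :
  u \in G -> v \in G -> u != 1 -> commute u v -> v \in <[u]>.
Proof.
move=> Gu Gv nu cuv; pose H := [group of <<[set u; v]>>].
have sHG : H \subset G by rewrite gen_subG subUset !sub1set Gu.
have [Hu Hv] : u \in H /\ v \in H by split; apply: mem_gen; rewrite !inE eqxx ?orbT.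
have abH : abelian H.
  rewrite abelian_gen; apply/centsP=> x + y.
  by rewrite !inE => /orP[] /eqP-> /orP[] /eqP->; rewrite // /commute cuv.
have nHG : H :!=: G by apply: contraNneq nabG => <-.
have [H1|prH] := proper_card_pq sHG nHG.
  by case/eqP: nu; apply/set1gP; rewrite -H1.
suff -> : <[u]> = H by [].
apply/eqP; rewrite eqEcard cycle_subG Hu /=.
have := cardSg (_ : <[u]> \subset H); rewrite cycle_subG Hu => /(_ isT).
case/(primeP prH).2/orP=> /eqP ou; last by rewrite -ou.
by case/eqP: nu; apply/eqP; rewrite -order_eq1 /order ou.
Qed.

(** The number of Sylow [p]-subgroups divides [p * q] and is 1 modulo [p]; the candidate [q] fails
    because [1 < q < p]. *)
Lemma Sylow_normal_pq : exists2 P : {group gT}, P <| G & #|P| = p.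
Proof.
have /normal_sylowP[P sylP nPG] : #|'Syl_p(G)| == 1%N.
  have := dvdn_mul_primes pp pq; rewrite -oG => /(_ _ (card_Syl_dvd p G)).
  have := card_Syl_mod G pp.
  rewrite !inE oG => nmod /or4P[] // /eqP nE; move: nmod.
  - by rewrite nE modnn.
  - by rewrite nE modn_small // => q1; have := prime_gt1 pq; rewrite q1.
  - by rewrite nE modnMr.
exists P => //; rewrite (card_Hall sylP) oG partnM ?prime_gt0 //.
rewrite part_pnat_id ?pnat_id // part_p'nat ?muln1 // p'natE //.
by rewrite dvdn_prime2 //; apply: contraL ltqp => /eqP->; rewrite ltnn.
Qed.

(** Normality of [P] puts the class inside the coset, and both have [p] elements once ['C_P[u]] is
    trivial. Otherwise [u] would centralise the abelian [P], and [G], generated by [P] and [u],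
    would be abelian. *)
Lemma lcoset_class_pq (P : {group gT}) (u : gT) :
  P <| G -> #|P| = p -> u \in G -> u \notin P -> u ^: P = u *: P.
Proof.
move=> nPG oP Gu Pu; have sPG := normal_sub nPG.
have nPu : u \in 'N(P) by apply: subsetP Gu; apply: normal_norm.
have abP : abelian P by apply/cyclic_abelian/prime_cyclic; rewrite oP.
have defG : P <*> <[u]> = G.
  apply/eqP; apply: contraNT Pu => nG.
  have sHG : P <*> <[u]> \subset G by rewrite join_subG sPG cycle_subG.
  have sPH : P \subset P <*> <[u]> by apply: joing_subl.
  suff -> : P :=: P <*> <[u]> by rewrite mem_gen // inE cycle_id orbT.
  have [H1 | prH] := proper_card_pq sHG nG.
    by apply/eqP; rewrite eqEsubset sPH H1 sub1G.
  apply/eqP; rewrite eqEcard sPH /=.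
  case/(primeP prH).2/orP: (cardSg sPH) => /eqP E; last by rewrite E.
  by move: pp; rewrite -oP E.
have cP1 : 'C_P[u] = 1.
  have: #|'C_P[u]| %| p by rewrite -oP cardSg ?subsetIl.
  case/(primeP pp).2/orP=> /eqP oC; first exact: card1_trivg.
  case/negP: nabG; rewrite -defG abelianY cycle_abelian abP /=.
  rewrite cycle_subG -sub_cent1.
  by apply/setIidPl/eqP; rewrite eqEcard subsetIl oP oC leqnn.
apply/eqP; rewrite eqEcard card_lcoset -index_cent1 cP1 indexg1 leqnn andbT.
apply/subsetP=> _ /imsetP[k Pk ->]; rewrite mem_lcoset conjgE.
have -> : u^-1 * (k^-1 * (u * k)) = k^-1 ^ u * k by rewrite conjgE !mulgA.
by rewrite groupM // memJ_norm ?groupV.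
Qed.

Lemma avoidable_commute (U : {set gT}) :
  odd #|G| -> avoidable G U -> {in U &, forall u v, commute u v}.
Proof.
move=> oddG avU; have sUG : U \subset G by case/andP: avU.
have [A sAG colA] := avoidable_coloring avU.
have [P nPG oP] := Sylow_normal_pq.
move=> u v Uu Uv; apply/eqP; apply: contraNT nabG => ncuv.
have abP : abelian P by apply/cyclic_abelian/prime_cyclic; rewrite oP.
pose H := [group of <<[set u; v]>>].
have sHG : H \subset G by rewrite gen_subG subUset !sub1set !(subsetP sUG).
have nHG : H :=: G.
  have [//|nHG] := eqVneq (H : {set gT}) G; case/eqP: ncuv.
  have [Hu Hv] : u \in H /\ v \in H by split; apply: mem_gen; rewrite !inE eqxx ?orbT.
  have abH : abelian H.
    have [-> | prH] := proper_card_pq sHG nHG; first exact: abelian1.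
    exact/cyclic_abelian/prime_cyclic.
  exact: (centsP abH).
have nAG : G \subset 'N(A).
  rewrite -nHG gen_subG subUset !sub1set.
  by rewrite !(coloring_norm sUG sAG colA).
(* This puts [u] and [v] in the abelian [P], although they do not commute. *)
have UP x : x \in U -> x \in P.
  move=> Ux; apply: contraT => Px; have Gx := subsetP sUG x Ux.
  have [w xw w2] := odd_sqrt oddG Gx.
  have Gw : w \in G by apply: subsetP xw; rewrite cycle_subG.
  have Pw : w \notin P by apply: contra Px; rewrite -w2; apply: groupX.
  have clw := lcoset_class_pq nPG oP Gw Pw.
  have wA y : y \in w *: P -> (y \in A) = (w \in A).
    rewrite -clw => /imsetP[k Pk ->]; apply: memJ_norm.
    by rewrite (subsetP nAG) // (subsetP (normal_sub nPG)).
  have /trivgPn[k Pk nk] : P :!=: 1 by rewrite -cardG_gt1 oP prime_gt1.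
  have wkP : w * k \in w *: P by rewrite mem_lcoset mulKg.
  have Gwk : w * k \in G by rewrite groupM // (subsetP (normal_sub nPG)).
  have nwk : (w * k) ^+ 2 != x.
    apply: contra nk; rewrite -w2 => /eqP/(odd_sqrt_inj oddG Gwk Gw)/eqP.
    by rewrite -{2}[w]mulg1 => /eqP/mulgI->.
  have := coloring_step sUG colA Ux Gwk nwk; rewrite (wA _ wkP) wA ?(negPf nk).
    by case: (w \in A).
  (* The step sends [w * k] to [k^-1 * w], which is in [w *: P] by normality. *)
  rewrite -w2 expgS expg1 invMg -mulgA mulKg mem_lcoset -conjgE.
  by rewrite memJ_norm ?groupV // (subsetP (normal_norm nPG)).
by case/eqP: ncuv; apply: (centsP abP); apply: UP.
Qed.

End OrderPQ.

Theorem theorem4p11 (p q s : nat) (gT : finGroupType) (G : {group gT}) :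
  prime p -> prime q -> odd p -> odd q -> (q < p)%N ->
  p = 1 %[mod q] ->
  s <> 1 %[mod p] -> (s ^ q)%N = 1 %[mod p] ->
  ~~ abelian G -> #|G| = (p * q)%N ->
  G \isog Grp (a : b : a ^+ q, b ^+ p, b * a = a * b ^+ s) ->
  forall U : {set gT}, saturated G U ->
    exists2 x : gT, x \in G & exists n : nat, U = [set x; x ^+ n].
Proof.
move=> pp pq odd_p odd_q ltqp _ _ _ nabG oG _ U /maxsetP[avU maxU].
have oddG : odd #|G| by rewrite oG oddM odd_p.
have ntG : G :!=: 1 by apply: contraNneq nabG => ->; apply: abelian1.
have comU := avoidable_commute pp pq ltqp nabG oG oddG avU.
have sUG : U \subset G by case/andP: avU.
have [A sAG colA] := avoidable_coloring avU.
have [u Uu] : exists u, u \in U.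
  apply/set0Pn; apply/eqP=> U0.
  have := maxU _ (avoidable1 oddG ntG); rewrite U0 sub0set => /(_ isT)/setP/(_ 1).
  by rewrite !inE eqxx.
have Gu := subsetP sUG u Uu.
have [U1 | /subsetPn[v Uv]] := boolP (U \subset [set u]).
  exists u => //; exists 1%N; rewrite expg1 setUid.
  by apply/eqP; rewrite eqEsubset U1 sub1set.
rewrite inE => nvu; have Gv := subsetP sUG v Uv.
have defU : U = [set u; v].
  apply/eqP; rewrite eq_sym eqEsubset subUset !sub1set Uu Uv /=.
  apply/subsetP=> w Uw; rewrite !inE; apply/norP=> [[nwu nwv]].
  apply: (no_commuting_triple oddG sUG colA Uu Uv Uw); rewrite 1?eq_sym //; exact: comU.
(* The trivial element generates nothing else, so for [u = 1] the roles are exchanged and [u] is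
   [v ^+ 0]. *)
have [u1 | nu1] := eqVneq u 1.
  by exists v => //; exists 0%N; rewrite defU u1 setUC.
have /cycleP[n vE] := commute_cycle pp pq nabG oG Gu Gv nu1 (comU _ _ Uu Uv).
by exists u => //; exists n; rewrite -vE.
Qed.
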